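(* Let $m,u\ge 2$, $p\ge 1$ and $n,v\ge 0$ be integers. For integers $N,M,j\ge 0$ let $\mathcal{A}_p(N,M,j)$ denote the set of all $N$-tuples $(a_1,\dots,a_N)$ of positive integer multiples of $p$ with $a_1+\dots+a_N=Mp$ and such that exactly $j$ of the entries $a_s$ are even multiples of $p$ (i.e. of the form $rp$ with $r$ even). Then $$ \begin{aligned} &\zeta^t(m,\{p\}^n)\,\zeta^t(u,\{p\}^v)\\ ={}&\sum_{l=1}^{n}\ \sum_{k=0}^{\min\{v,n-l\}}\ \sum_{\substack{i+j=k\\ i,j\ge 0}}\ \sum_{(a_1,\dots,a_N)\in\mathcal{A}_p(N,\,n+v-l,\,j)} \binom{v+n-l-2k}{v-k}(t^2-t)^i(1-2t)^j\\ &\quad\times\Big[\zeta^t(m,\{p\}^l,u,a_1,\dots,a_N)+(1-2t)\zeta^t(m,\{p\}^{l-1},u+p,a_1,\dots,a_N)\\ &\qquad\ +(1-\delta_{v,0}\delta_{n,l})(t^2-t)\zeta^t(m,\{p\}^{l-1},u+p+a_1,a_2,\dots,a_N)\Big]\\ &+\sum_{l=1}^{v}\ \sum_{k=0}^{\min\{n,v-l\}}\ \sum_{\substack{i+j=k\\ i,j\ge 0}}\ \sum_{(a_1,\dots,a_N)\in\mathcal{A}_p(N,\,n+v-l,\,j)} \binom{v+n-l-2k}{n-k}(t^2-t)^i(1-2t)^j\\ &\quad\times\Big[\zeta^t(u,\{p\}^l,m,a_1,\dots,a_N)+(1-2t)\zeta^t(u,\{p\}^{l-1},m+p,a_1,\dots,a_N)\\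 &\qquad\ +(1-\delta_{n,0}\delta_{v,l})(t^2-t)\zeta^t(u,\{p\}^{l-1},m+p+a_1,a_2,\dots,a_N)\Big]\\ &+\sum_{k=0}^{\min\{n,v\}}\ \sum_{\substack{i+j=k\\ i,j\ge 0}}\ \sum_{(a_1,\dots,a_{N'})\in\mathcal{A}_p(N',\,n+v,\,j)} \binom{v+n-2k}{n-k}(t^2-t)^i(1-2t)^j\\ &\quad\times\Big[\zeta^t(m,u,a_1,\dots,a_{N'})+\zeta^t(u,m,a_1,\dots,a_{N'})+(1-2t)\zeta^t(m+u,a_1,\dots,a_{N'})\\ &\qquad\ +(1-\delta_{n,0}\delta_{v,0})(t^2-t)\zeta^t(m+u+a_1,a_2,\dots,a_{N'})\Big], \end{aligned} $$ where $N=v+n-l-i-k$ in the first two sums and $N'=v+n-i-k$ in the third.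
   Context: For positive integers $k_1,\dots,k_n$ with $k_1\ge 2$ (an admissible index), the multiple zeta value is $\zeta(k_1,\dots,k_n)=\sum_{m_1>\cdots>m_n\ge 1}\frac{1}{m_1^{k_1}\cdots m_n^{k_n}}$, and the interpolated multiple zeta value is the polynomial $$\zeta^t(k_1,\dots,k_n)=\sum_{\mathbf p}t^{\,n-\mathrm{dep}(\mathbf p)}\zeta(\mathbf p)\in\mathbb{R}[t],$$ where $\mathbf p$ runs over the $2^{n-1}$ indices $(k_1\Box k_2\Box\cdots\Box k_n)$ obtained by replacing each $\Box$ by either a comma or a plus sign, and $\mathrm{dep}(\mathbf p)$ is the number of entries of $\mathbf p$. $\{p\}^l$ denotes $p$ repeated $l$ times (omitted if $l=0$); $\delta_{i,j}$ is Kronecker's delta. Empty sums are $0$; $\mathcal{A}_p(0,0,0)$ consists of the empty tuple and $\mathcal{A}_p(0,M,j)$ is empty for $(M,j)\ne(0,0)$. A term involving $a_1$ when there is no $a_1$ (empty tuple) occurs only with coefficient $1-\delta\delta=0$ and is read as $0$. *)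

(* Defs.v *)
From HB Require Import structures.
From mathcomp Require Export all_boot all_order all_algebra.
From mathcomp Require Export boolp classical_sets reals ereal esum.

Set Implicit Arguments.
Unset Strict Implicit.
Unset Printing Implicit Defensive.

Import GRing.Theory.

Local Open Scope classical_set_scope.
Local Open Scope ring_scope.

Definition mzv_index (n : nat) : set (seq nat) :=
  [set m | [/\ size m = n, sorted gtn m & all (leq 1) m]].

(* The terms are nonnegative, so their unordered sum always exists in \bar R;
   it is finite when k is admissible, and fine sends a divergent sum to 0. *)
Definition mzv (R : realType) (k : seq nat) : R :=
  fine (\esum_(m in mzv_index (size k))
          (\prod_(i < size k) (nth 0%N m i)%:R ^- nth 0%N k i)%:E).

(* box_fill k1 [:: k2; ...; kn] [:: b1; ...; b(n-1)] is k1 [] k2 [] ... [] kn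
   with the s-th box a plus sign when bs is true and a comma when it is false. *)
Fixpoint box_fill (k1 : nat) (ks : seq nat) (b : bitseq) : seq nat :=
  match ks, b with
  | k2 :: ks', true :: b' => box_fill (k1 + k2)%N ks' b'
  | k2 :: ks', false :: b' => k1 :: box_fill k2 ks' b'
  | _, _ => [:: k1]
  end.

(* The interpolation parameter t is 'X. The value 0 at the empty index is
   a dummy. *)
Definition mzvt (R : realType) (k : seq nat) : {poly R} :=
  if k is k1 :: ks then
    \sum_(b : (size ks).-tuple bool)
      mzv R (box_fill k1 ks b) *: 'X^(size k - size (box_fill k1 ks b))%N
  else 0.

Definition in_calA (p N M j : nat) (a : seq nat) : bool :=
  [&& size a == N,
      all (fun x => (0 < x)%N && (p %| x)%N) a,
      sumn a == (M * p)%N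
    & count (fun x => ~~ odd (x %/ p)) a == j].

(* Entries of a tuple with sum M * p are at most M * p, so enumerating the
   bounded tuples loses nothing: see mem_calA and calA_uniq. *)
Definition calA (p N M j : nat) : seq (seq nat) :=
  [seq a <- [seq map val b | b : N.-tuple 'I_(M * p).+1] | in_calA p N M j a].

Lemma mem_calA (p N M j : nat) (a : seq nat) :
  (a \in calA p N M j) = in_calA p N M j a.
Proof.
rewrite mem_filter; case: (boolP (in_calA _ _ _ _ _)) => //= /and4P[/eqP sa _ /eqP suma _].
have le_a x : x \in a -> (x < (M * p).+1)%N.
  rewrite -suma ltnS sumnE => /(big_rem x) ->; exact: leq_addr.
have sb : size [seq inord x : 'I_(M * p).+1 | x <- a] == N by rewrite size_map sa.
apply/fintype.imageP; exists (Tuple sb) => //=; rewrite -map_comp -[LHS]map_id.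
by apply/eq_in_map => x /le_a xM /=; rewrite inordK.
Qed.

Lemma calA_uniq (p N M j : nat) : uniq (calA p N M j).
Proof.
apply: filter_uniq; rewrite map_inj_uniq ?enum_uniq// => b c.
by move=> /(inj_map val_inj)/val_inj.
Qed.

(* Main.v *)
Require Import Defs.
From mathcomp Require Import functions cardinality fsbigop topology normedtype sequences.
From mathcomp Require Import zify ring lra.

(* Truncating at m_1 <= M, the value of zeta^t is a sum over M >= m_1 >= ... >= m_n
   in which every equality m_s = m_(s+1) contributes a factor t.  Comparing
   increments in M, these truncations satisfy for each M the t-harmonic rule
     (a w)*(b w') = a(w * b w') + b(a w * w') + (1 - 2t) (a+b)(w * w')
                    + (t^2 - t) ((a+b) added to the first letter of w * w').
   By induction {p}^n * {p}^v is the sum of all words in multiples of p of total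
   (n+v)p, weighted by powers of t^2 - t and 1 - 2t and a binomial coefficient
   (Pascal's rule is the recursion on
   a leading p); peeling the p's in front of u in {p}^n * u{p}^v and then m and u
   themselves gives the formula for the truncations.  Letting M tend to infinity
   proves it at every real t, hence as an identity of polynomials. *)

Set Implicit Arguments.
Unset Strict Implicit.
Unset Printing Implicit Defensive.

Import Order.TTheory GRing.Theory Num.Theory.
Import numFieldNormedType.Exports.

Local Open Scope ring_scope.

(** * Words in multiples of p *)

(** With [evens] below, a letter rp will carry the weight (t^2 - t)^q if r = 2q + 1, and (t^2 -
    t)^(q - 1) (1 - 2t) if r = 2q. *)
Definition halves (p : nat) (a : seq nat) := sumn [seq (x %/ p)./2 | x <- a].

Definition evens (p : nat) (a : seq nat) := count (fun x => ~~ odd (x %/ p)) a.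

Fixpoint comps (p M : nat) : seq (seq nat) :=
  if M is M'.+1 then
    [seq p :: a | a <- comps p M'] ++
    [seq (p + head 0 a)%N :: behead a | a <- comps p M' & a != [::]]
  else [:: [::]].

Definition in_comps (p M : nat) (a : seq nat) : bool :=
  all (fun x => (0 < x)%N && (p %| x)%N) a && (sumn a == (M * p)%N).

(** Each unit of [k] takes one [p] from both factors; the remaining [n - k] and [v - k] letters are
    interleaved. The test is explicit because truncated subtraction would turn the binomial into 1
    for [k > n]. *)
Definition mult (n v k : nat) : nat :=
  if (k <= minn n v)%N then 'C(n + v - 2 * k, n - k) else 0.

Lemma comps_gt0 p M a : (0 < p)%N -> a \in comps p M ->
  all (fun x => (p <= x)%N) a.
Proof.
move=> p0; elim: M a => [|M IH] a /=; first by rewrite inE => /eqP->.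
rewrite mem_cat => /orP[] /mapP[b] + ->.
  by move=> /IH /=; rewrite leqnn.
rewrite mem_filter; case: b => //= x b /IH /= /andP[_ ->].
by rewrite leq_addr.
Qed.

Lemma mem_comps p M a : (0 < p)%N -> (a \in comps p M) = in_comps p M a.
Proof.
move=> p0; elim: M a => [|M IH] a.
  rewrite /in_comps mul0n inE; case: a => [|x a] //=.
  by case: x => //= x; rewrite addSn /= andbF.
apply/idP/idP => /=.
  rewrite mem_cat => /orP[] /mapP[b] + ->.
    rewrite IH /in_comps /= p0 dvdnn => /andP[-> /eqP ->] /=.
    by rewrite mulSn.
  rewrite mem_filter IH => /andP[]; case: b => //= x b _.
  rewrite /in_comps /= addn_gt0 p0 /= dvdn_addr//.
  by move=> /andP[/andP[/andP[_ ->] ->]] /= /eqP; rewrite -addnA mulSn => ->.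
case: a => [|x a]; rewrite /in_comps /=.
  by rewrite mulSn eq_sym addn_eq0 (gtn_eqF p0).
move=> /andP[/andP[/andP[x0 px] alla] /eqP sa].
have lpx := dvdn_leq x0 px; rewrite mem_cat; apply/orP.
have [xp|npx] := eqVneq p x.
  left; rewrite -xp; apply: map_f; rewrite IH /in_comps alla /=.
  by apply/eqP; move: sa; rewrite mulSn; lia.
right; apply/mapP; exists ((x - p)%N :: a); last by rewrite /= subnKC.
rewrite mem_filter IH /in_comps /= alla dvdn_subl // px /= subn_gt0.
by rewrite ltn_neqAle npx lpx; apply/eqP; move: sa; rewrite mulSn; lia.
Qed.

Lemma comps_uniq p M : (0 < p)%N -> uniq (comps p M).
Proof.
move=> p0; elim: M => //= M IH; rewrite cat_uniq; apply/and3P; split.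
- by rewrite map_inj_uniq// => a b [].
- apply/hasPn => _ /mapP[a + ->]; rewrite mem_filter => /andP[].
  case: a => //= x a _ /(comps_gt0 p0) /= /andP[px _].
  by apply/mapP => -[b _ [/eqP + _]]; rewrite -[X in _ == X]addn0 eqn_add2l; lia.
- rewrite map_inj_in_uniq ?filter_uniq// => a b.
  rewrite !mem_filter => /andP[+ _] /andP[+ _].
  by case: a b => [|x a] [|y b] //= _ _ [/addnI-> ->].
Qed.

(** Letter by letter: r is twice its rounded-down half plus 1, less 1 if r is even; a positive even
    r has half at least 1. *)
Lemma halves_evens p a : all (fun x => (0 < x)%N && (p %| x)%N) a -> (0 < p)%N ->
  (evens p a <= halves p a)%N /\ (sumn a = (2 * halves p a + size a - evens p a) * p)%N.
Proof.
move=> + p0; rewrite /evens /halves; elim: a => [|x a IH] //=.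
move=> /andP[/andP[x0 /dvdnP[q xE]] /IH[]].
have q0 : (0 < q)%N by move: x0; rewrite xE muln_gt0 => /andP[].
rewrite {}xE mulnK//.
set s := sumn a; set e := count _ a; set h := sumn _ => le_eh ->.
have := odd_double_half q; case: (odd q) => /= qE; split.
- by lia.
- by rewrite -mulnDl; congr (_ * _)%N; lia.
- by lia.
- by rewrite -mulnDl; congr (_ * _)%N; lia.
Qed.

Lemma mult_sym n v k : mult n v k = mult v n k.
Proof.
rewrite /mult minnC; case: ifP => // lek; rewrite [(n + v)%N]addnC -bin_sub; last by lia.
by congr 'C(_, _); lia.
Qed.

(** Pascal's rule; at k = n + 1 or k = v + 1 one summand vanishes and the other is 1. The bound
    excludes k = n + 1 = v + 1, where the left side is 1 and the right side 0. *)
Lemma mult_pascal n v k : (2 * k <= n + v + 1)%N ->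
  mult n.+1 v.+1 k = (mult n v.+1 k + mult n.+1 v k)%N.
Proof.
move=> lek; rewrite /mult; have [lekn|ltnk] := leqP k n.
  have [lekv|ltvk] := leqP k v.
    rewrite !ifT; try lia.
    have -> : (n.+1 + v.+1 - 2 * k = (n + v.+1 - 2 * k).+1)%N by lia.
    have -> : (n.+1 - k = (n - k).+1)%N by lia.
    by rewrite binS addnC; congr (_ + 'C(_, _))%N; lia.
  rewrite (_ : (k <= minn n.+1 v)%N = false) ?addn0; last by lia.
  case: ifP => lek1; last by rewrite ifF//; lia.
  rewrite ifT; last by lia.
  have -> : k = v.+1 by lia.
  have -> : (n.+1 + v.+1 - 2 * v.+1 = n.+1 - v.+1)%N by lia.
  have -> : (n + v.+1 - 2 * v.+1 = n - v.+1)%N by lia.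
  by rewrite !binn.
rewrite (_ : (k <= minn n v.+1)%N = false) ?add0n; last by lia.
case: ifP => lek1; last by rewrite ifF//; lia.
rewrite ifT; last by lia.
have -> : (n.+1 - k = 0)%N by lia.
by rewrite !bin0.
Qed.

(** * The t-harmonic product of two powers of one letter *)

Section PowerProduct.
Variables (A : comPzRingType) (t : A) (p : nat).
Hypothesis p0 : (0 < p)%N.

(* In the theorem's notation k = halves, j = evens and i = k - j; the subtraction
   is not truncated since evens <= halves on in_comps p (n + v). *)
Definition wt (n v : nat) (a : seq nat) : A :=
  (mult n v (halves p a))%:R * (t ^+ 2 - t) ^+ (halves p a - evens p a)
  * (1 - 2 * t) ^+ evens p a.

(* The t-harmonic product of {p}^n and {p}^v, evaluated by the linear extension
   of Z to combinations of words. *)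
Definition pprod (n v : nat) (Z : seq nat -> A) : A :=
  \sum_(a <- comps p (n + v)) wt n v a * Z a.

Definition addhead (Z : seq nat -> A) (b : nat) (a : seq nat) : A :=
  if a is a1 :: a' then Z ((b + a1)%N :: a') else 0.

Lemma sum_compsS M (Z : seq nat -> A) :
  \sum_(a <- comps p M.+1) Z a =
  \sum_(a <- comps p M) Z (p :: a) + \sum_(a <- comps p M) addhead Z p a.
Proof.
rewrite /= big_cat !big_map big_filter; congr (_ + _).
by rewrite big_mkcond; apply: eq_bigr => -[].
Qed.

Lemma sum_compsSS M (Z : seq nat -> A) :
  \sum_(a <- comps p M.+2) Z a =
  \sum_(a <- comps p M.+1) Z (p :: a) + \sum_(a <- comps p M) Z (2 * p :: a)%N
  + \sum_(a <- comps p M) addhead Z (2 * p) a.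
Proof.
rewrite sum_compsS -addrA; congr (_ + _); rewrite sum_compsS; congr (_ + _).
  by apply: eq_bigr => a _ /=; rewrite mul2n addnn.
by apply: eq_bigr => -[|x a] _ //=; rewrite mul2n -addnn addnA.
Qed.

Lemma wt_sym n v a : wt n v a = wt v n a.
Proof. by rewrite /wt mult_sym. Qed.

Lemma pprod_sym n v Z : pprod n v Z = pprod v n Z.
Proof. by rewrite /pprod addnC; apply: eq_bigr => a _; rewrite wt_sym. Qed.

Lemma wt_cons0 v a : wt 0 v.+1 (p :: a) = wt 0 v a.
Proof.
rewrite /wt /halves /evens /= divnn p0 /= !add0n /mult !min0n.
by case: leqP; rewrite // leqn0 => /eqP->; rewrite !bin0.
Qed.

(** A leading [p] changes neither [halves] nor [evens], so only Pascal's rule acts. Its bound holds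
    since twice [halves] is n + v + 1 - size + [evens], with [evens] at most the size. *)
Lemma wt_cons n v a : in_comps p (n + v).+1 a ->
  wt n.+1 v.+1 (p :: a) = wt n v.+1 a + wt n.+1 v a.
Proof.
move=> /andP[/halves_evens /(_ p0)[le_eh ->] /eqP/eqP].
rewrite eqn_pmul2r// => /eqP sa.
rewrite /wt /halves /evens /= divnn p0 /= !add0n.
rewrite mult_pascal ?natrD ?mulrDl//.
have : (evens p a <= size a)%N by exact: count_size.
by rewrite -/(halves p a) -/(evens p a); lia.
Qed.

Lemma wt_cons2 n v a : wt n.+1 v.+1 (2 * p :: a)%N = (1 - 2 * t) * wt n v a.
Proof.
rewrite /wt /halves /evens /= mulnK//= -/(halves p a) -/(evens p a) !add1n.
have -> : mult n.+1 v.+1 (halves p a).+1 = mult n v (halves p a).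
  by rewrite /mult minnSS ltnS subSS; case: ifP => // _; congr 'C(_, _); lia.
by rewrite subSS [(1 - 2 * t) ^+ _.+1]exprS; ring.
Qed.

(** Adding [2 * p] keeps the parity of the multiple and raises [halves] by one. The hypothesis keeps
    the exponent [halves - evens] from being truncated. *)
Lemma wt_add2 n v x a : (evens p (x :: a) <= halves p (x :: a))%N ->
  wt n.+1 v.+1 (2 * p + x :: a)%N = (t ^+ 2 - t) * wt n v (x :: a).
Proof.
rewrite /wt /halves /evens /= divnMDl//= negbK.
set k := (_./2 + _)%N; set e := (_ + _)%N => le_ek.
have -> : mult n.+1 v.+1 ((x %/ p)./2.+1 + sumn [seq (x0 %/ p)./2 | x0 <- a])%N = mult n v k.
  by rewrite /mult addSn minnSS ltnS subSS; case: ifP => // _; congr 'C(_, _); lia.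
by rewrite addSn subSn// [(t ^+ 2 - t) ^+ _.+1]exprS; ring.
Qed.

Lemma pprod00 Z : pprod 0 0 Z = Z [::].
Proof. by rewrite /pprod /= big_seq1 /wt /mult /= !expr0 !mulr1 mul1r. Qed.

Lemma pprod0S v Z : pprod 0 v.+1 Z = pprod 0 v (fun a => Z (p :: a)).
Proof.
rewrite /pprod !add0n sum_compsS.
rewrite [X in _ + X]big1_seq ?addr0.
  by apply: eq_bigr => a _; rewrite wt_cons0.
(* A first letter of at least [2 * p] makes [halves] positive, where [mult 0 v] vanishes. *)
move=> [|x a] //= /(comps_gt0 p0)/= /andP[px _].
have : (0 < ((p + x) %/ p)./2)%N.
  by rewrite -[X in (X + x)%N]mul1n divnMDl// half_gt0 add1n ltnS divn_gt0.
rewrite /wt /halves /mult /=; case: (_./2) => // k _.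
by rewrite min0n addSn /= !mul0r.
Qed.

(** The t-harmonic rule for two words starting with [p], obtained by sorting words by their first
    letter: [p], [2 * p] or more. *)
Lemma pprodSS n v Z : pprod n.+1 v.+1 Z =
  pprod n v.+1 (fun a => Z (p :: a)) + pprod n.+1 v (fun a => Z (p :: a))
  + (1 - 2 * t) * pprod n v (fun a => Z (2 * p :: a)%N)
  + (t ^+ 2 - t) * pprod n v (addhead Z (2 * p)).
Proof.
rewrite /pprod !addnS !addSn sum_compsSS -big_split !mulr_sumr.
congr (_ + _ + _).
- apply: eq_big_seq => a; rewrite mem_comps// => ha.
  by rewrite /= wt_cons// mulrDl.
- by apply: eq_bigr => a _; rewrite wt_cons2 -mulrA.
- apply: eq_big_seq => a; case: a => [|x a]; rewrite /= ?mulr0//.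
  rewrite mem_comps// => /andP[/halves_evens /(_ p0)[le_eh _] _].
  by rewrite wt_add2// mulrA.
Qed.

(** * Comparison with the sums over [calA] *)

Lemma perm_calA N M j :
  perm_eq (calA p N M j)
    [seq a <- comps p M | (size a == N) && (evens p a == j)].
Proof.
apply: uniq_perm; rewrite ?calA_uniq ?filter_uniq ?comps_uniq// => a.
rewrite mem_calA mem_filter mem_comps// /in_calA /in_comps /evens.
by case: (size a == N); case: all; case: (sumn a == _); rewrite ?andbT ?andbF.
Qed.

(** With k = [halves], j = [evens] and i = k - j, the equation reads N = M - i - k. *)
Lemma in_comps_size M a : in_comps p M a ->
  (evens p a <= halves p a)%N /\ (size a + 2 * halves p a = M + evens p a)%N.
Proof.
case/andP => /halves_evens /(_ p0)[le_eh ->]; rewrite eqn_pmul2r// => /eqP <-.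
have : (evens p a <= size a)%N by exact: count_size.
by split=> //; lia.
Qed.

(** A word occurs only for k = [halves], j = [evens] and i = k - j, since its length and j determine
    k and i. *)
Lemma sum_calA n v (Z : seq nat -> A) :
  \sum_(0 <= k < (minn n v).+1)
   \sum_(i < k.+1) \sum_(j < k.+1 | (i + j == k)%N)
    \sum_(a <- calA p (n + v - i - k) (n + v) j)
     'C(n + v - 2 * k, n - k)%:R
     * (t ^+ 2 - t) ^+ i * (1 - 2 * t) ^+ j * Z a = pprod n v Z.
Proof.
pose F a k i j := if (size a == n + v - i - k)%N && (evens p a == j) then
  'C(n + v - 2 * k, n - k)%:R * (t ^+ 2 - t) ^+ i * (1 - 2 * t) ^+ j * Z a
  else 0.
transitivity (\sum_(a <- comps p (n + v)) \sum_(0 <= k < (minn n v).+1)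
   \sum_(i < k.+1) \sum_(j < k.+1 | (i + j == k)%N) F a k i j).
  rewrite exchange_big; apply: eq_bigr => k _.
  rewrite exchange_big; apply: eq_bigr => i _.
  rewrite exchange_big; apply: eq_bigr => j _ /=.
  by rewrite (perm_big _ (perm_calA _ _ _)) big_filter big_mkcond.
apply: eq_big_seq => a; rewrite mem_comps// => /in_comps_size[leJK sa].
set K := halves p a in leJK sa *; set J := evens p a in leJK sa *.
transitivity (\sum_(0 <= k < (minn n v).+1 | k == K)
  \sum_(i < k.+1 | i == (K - J)%N :> nat) \sum_(j < k.+1 | j == J :> nat)
  ('C(n + v - 2 * k, n - k)%:R * (t ^+ 2 - t) ^+ i * (1 - 2 * t) ^+ j * Z a)).
  rewrite [RHS]big_mkcond; apply: eq_big_nat => k /andP[_ lek].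
  (* As i <= k, the subtraction in the length n + v - i - k is not truncated. *)
  have le2k : (2 * k <= n + v)%N by lia.
  case: eqVneq => [kK|nkK]; last first.
    rewrite big1// => i _; rewrite big1// => j /eqP ij.
    by rewrite /F ifF//; apply/negbTE/negP => /andP[/eqP s1 /eqP s2]; lia.
  rewrite [RHS]big_mkcond; apply: eq_bigr => i _.
  case: eqVneq => [iKJ|niKJ].
    rewrite big_mkcond [RHS]big_mkcond; apply: eq_bigr => j _; rewrite /F.
    have -> : (i + j == k)%N = (nat_of_ord j == J) by lia.
    by case: eqVneq => // jJ; rewrite ifT//; apply/andP; split; apply/eqP; lia.
  rewrite big1// => j /eqP ij.
  by rewrite /F ifF//; apply/negbTE/negP => /andP[/eqP s1 /eqP s2]; lia.
rewrite big_nat1_eq /= ltnS /wt /mult; case: leqP => [leK|_]; last first.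
  by rewrite !mul0r.
pose f i j : A := 'C(n + v - 2 * K, n - K)%:R * (t ^+ 2 - t) ^+ i * (1 - 2 * t) ^+ j * Z a.
rewrite (big_ord1_eq _ (fun i => \sum_(j < K.+1 | j == J :> nat) f i j)) ltnS leq_subr.
by rewrite (big_ord1_eq _ (f (K - J)%N)) ltnS leJK.
Qed.
Lemma eq_pprod n v (Z Z' : seq nat -> A) : Z =1 Z' -> pprod n v Z = pprod n v Z'.
Proof. by move=> ZZ'; apply: eq_bigr => a _; rewrite ZZ'. Qed.

Lemma pprodD n v (Z Z' : seq nat -> A) :
  pprod n v (fun a => Z a + Z' a) = pprod n v Z + pprod n v Z'.
Proof. by rewrite -big_split; apply: eq_bigr => a _; rewrite mulrDr. Qed.

Lemma pprodZ n v c (Z : seq nat -> A) :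
  pprod n v (fun a => c * Z a) = c * pprod n v Z.
Proof. by rewrite mulr_sumr; apply: eq_bigr => a _; ring. Qed.

(** The two merging terms of the t-harmonic rule behind a prefix; [b] is the sum of the merged
    letters. *)
Definition absorb (Z : seq nat -> A) (pre : seq nat) (b : nat) (a : seq nat) : A :=
  (1 - 2 * t) * Z (pre ++ b :: a)
  + (t ^+ 2 - t) * addhead (fun a' => Z (pre ++ a')) b a.

(** The right side of the theorem with the sums over k, i, j and words folded into [pprod]. The
    Kronecker factors are encoded by [addhead] being 0 at the empty word. *)
Definition expansion (Z : seq nat -> A) (m u n v : nat) : A :=
  \sum_(1 <= l < n.+1) pprod v (n - l) (fun a =>
    Z (m :: nseq l p ++ u :: a) + absorb Z (m :: nseq (l - 1) p) (u + p) a)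
  + \sum_(1 <= l < v.+1) pprod n (v - l) (fun a =>
    Z (u :: nseq l p ++ m :: a) + absorb Z (u :: nseq (l - 1) p) (m + p) a)
  + pprod n v (fun a =>
    Z [:: m, u & a] + Z [:: u, m & a] + absorb Z [::] (m + u) a).

End PowerProduct.
(** * Truncated interpolated sums *)

Section TruncatedProduct.
Variables (A : comPzRingType) (t : A) (y : nat -> A).

(* When y r = 1/(r+1), prepending the letter b to a word turns its sum f over
   M >= m_1 >= m_2 >= ... into qsum b f: the increment f r.+1 - f r collects the
   terms whose first index equals the new one r.+1, which carry a factor t.
   Adding b to the first letter instead gives dsum b f. *)
Definition qsum (b : nat) (f : nat -> A) (M : nat) : A :=
  \sum_(r < M) y r ^+ b * (f r + t * (f r.+1 - f r)).

Definition dsum (b : nat) (f : nat -> A) (M : nat) : A :=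
  \sum_(r < M) y r ^+ b * (f r.+1 - f r).

Fixpoint trunct (k : seq nat) : nat -> A :=
  if k is b :: k' then qsum b (trunct k') else fun=> 1.

Lemma eq_qsum b f g M : f =1 g -> qsum b f M = qsum b g M.
Proof. by move=> fg; apply: eq_bigr => r _; rewrite !fg. Qed.

Lemma eq_dsum b f g M : f =1 g -> dsum b f M = dsum b g M.
Proof. by move=> fg; apply: eq_bigr => r _; rewrite !fg. Qed.

(** Induction on [M]: the increments agree by algebra. In the first two terms the inner product
    jumps as well, which creates terms in y^(b + c) that the last two correct. *)
Lemma qsum_mul b c f g M :
  qsum b f M * qsum c g M =
    qsum b (fun r => f r * qsum c g r) M + qsum c (fun r => qsum b f r * g r) M
    + (1 - 2 * t) * qsum (b + c) (fun r => f r * g r) M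
    + (t ^+ 2 - t) * dsum (b + c) (fun r => f r * g r) M.
Proof.
elim: M => [|M IH]; first by rewrite /qsum /dsum !big_ord0 !mulr0 !addr0.
have qsumS a h : qsum a h M.+1 = qsum a h M + y M ^+ a * (h M + t * (h M.+1 - h M)).
  by rewrite /qsum big_ord_recr.
have dsumS a h : dsum a h M.+1 = dsum a h M + y M ^+ a * (h M.+1 - h M).
  by rewrite /dsum big_ord_recr.
rewrite !qsumS dsumS exprD.
have mulDD (a a' d d' : A) : (a + d) * (a' + d') = a * a' + (a * d' + d * a' + d * d').
  by ring.
rewrite [LHS]mulDD IH; ring.
Qed.

(** The increment of [trunct (c :: k)] carries y^c, which merges with y^b. The empty word is
    constant, so its increment 0 matches the default of [addhead]. *)
Lemma dsum_trunct b k M :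
  dsum b (trunct k) M = addhead (fun k' => trunct k' M) b k.
Proof.
case: k => [|c k] /=; first by rewrite /dsum big1// => r _; rewrite subrr mulr0.
apply: eq_bigr => r _; rewrite [X in X - _]/qsum big_ord_recr /= -/(qsum c _ r).
by rewrite addrAC subrr add0r mulrA exprD.
Qed.

Lemma qsum_sum (I : Type) (s : seq I) (c : I -> A) (f : I -> nat -> A) b M :
  qsum b (fun r => \sum_(i <- s) c i * f i r) M = \sum_(i <- s) c i * qsum b (f i) M.
Proof.
transitivity (\sum_(r < M) \sum_(i <- s)
   c i * (y r ^+ b * (f i r + t * (f i r.+1 - f i r)))).
  apply: eq_bigr => r _; rewrite -sumrB mulr_sumr -big_split mulr_sumr /=.
  by apply: eq_bigr => i _; ring.
by rewrite exchange_big; apply: eq_bigr => i _; rewrite mulr_sumr.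
Qed.

Lemma dsum_sum (I : Type) (s : seq I) (c : I -> A) (f : I -> nat -> A) b M :
  dsum b (fun r => \sum_(i <- s) c i * f i r) M = \sum_(i <- s) c i * dsum b (f i) M.
Proof.
transitivity (\sum_(r < M) \sum_(i <- s) c i * (y r ^+ b * (f i r.+1 - f i r))).
  apply: eq_bigr => r _; rewrite -sumrB mulr_sumr /=.
  by apply: eq_bigr => i _; ring.
by rewrite exchange_big; apply: eq_bigr => i _; rewrite mulr_sumr.
Qed.

Lemma qsumD b f g M : qsum b (fun r => f r + g r) M = qsum b f M + qsum b g M.
Proof. by rewrite -big_split; apply: eq_bigr => r _ /=; ring. Qed.

Lemma qsumZ b c f M : qsum b (fun r => c * f r) M = c * qsum b f M.
Proof. by rewrite mulr_sumr; apply: eq_bigr => r _ /=; ring. Qed.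

Lemma qsum0 b M : qsum b (fun=> 0) M = 0.
Proof. by rewrite /qsum big1// => r _; rewrite subrr mulr0 addr0 mulr0. Qed.

Variable p : nat.
Hypothesis p0 : (0 < p)%N.

Notation pprod := (pprod t p).

(** Induction on both exponents: [qsum_mul] and [pprodSS] give the same recursion, with
    [dsum_trunct] matching the last term. *)
Lemma trunct_nseq_mul n v M :
  trunct (nseq n p) M * trunct (nseq v p) M = pprod n v (fun a => trunct a M).
Proof.
elim: n v M => [|n IHn] v M.
  rewrite mul1r; elim: v M => [|v IHv] M; first by rewrite pprod00.
  rewrite (pprod0S _ p0) /= /pprod -qsum_sum; apply: eq_qsum => r.
  by rewrite IHv.
elim: v M => [|v IHv] M.
  rewrite mulr1 pprod_sym (pprod0S _ p0) /= /pprod -qsum_sum; apply: eq_qsum => r.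
  by have := IHn 0 r; rewrite mulr1 pprod_sym => ->.
rewrite (pprodSS _ p0) [LHS]qsum_mul addnn -mul2n; congr (_ + _ + _ * _ + _ * _).
- by rewrite /pprod -qsum_sum; apply: eq_qsum => r; rewrite -[RHS]IHn.
- by rewrite /pprod -qsum_sum; apply: eq_qsum => r; rewrite -[RHS]IHv.
- by rewrite /pprod -qsum_sum; apply: eq_qsum => r; rewrite -[RHS]IHn.
- rewrite (eq_dsum _ _ (fun r => IHn v r)) dsum_sum; apply: eq_bigr => a _.
  by rewrite dsum_trunct.
Qed.

Lemma qsum_pprod b n v (Z : seq nat -> nat -> A) M :
  qsum b (fun r => pprod n v (Z^~ r)) M = pprod n v (fun a => qsum b (Z a) M).
Proof. exact: qsum_sum. Qed.

Lemma qsum_absorb b pre c a M :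
  qsum b (fun r => absorb t (trunct^~ r) pre c a) M =
  absorb t (trunct^~ M) (b :: pre) c a.
Proof.
rewrite qsumD !qsumZ; congr (_ + _ * _).
by case: a => [|x a] //=; rewrite qsum0.
Qed.

Lemma absorb_pprod b n v M :
  (1 - 2 * t) * qsum b (fun r => pprod n v (trunct^~ r)) M
  + (t ^+ 2 - t) * dsum b (fun r => pprod n v (trunct^~ r)) M
  = pprod n v (absorb t (trunct^~ M) [::] b).
Proof.
rewrite qsum_pprod dsum_sum -!pprodZ -pprodD; apply: eq_pprod => a.
by rewrite dsum_trunct.
Qed.

(** Kept general in [b], which is [p] in the next induction and then [m] and [u] in the full
    product. *)
Lemma qsum_expand b w c n v M :
  qsum b (fun r => \sum_(1 <= l < n.+1) pprod v (n - l) (fun a =>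
      trunct (nseq l p ++ w :: a) r
      + absorb t (trunct^~ r) (nseq (l - 1) p) c a)
    + pprod n v (fun a => trunct (w :: a) r)) M =
  \sum_(1 <= l < n.+1) pprod v (n - l) (fun a =>
      trunct (b :: nseq l p ++ w :: a) M
      + absorb t (trunct^~ M) (b :: nseq (l - 1) p) c a)
    + pprod n v (fun a => trunct [:: b, w & a] M).
Proof.
rewrite qsumD qsum_pprod; congr (_ + _).
transitivity (qsum b (fun r => \sum_(1 <= l < n.+1) 1 * pprod v (n - l) (fun a =>
      trunct (nseq l p ++ w :: a) r
      + absorb t (trunct^~ r) (nseq (l - 1) p) c a)) M).
  by apply: eq_qsum => r; apply: eq_bigr => l _; rewrite mul1r.
rewrite qsum_sum; apply: eq_bigr => l _; rewrite mul1r qsum_pprod.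
by apply: eq_pprod => a; rewrite qsumD qsum_absorb.
Qed.

Lemma trunct_nseq_mul_cons u n v M :
  trunct (nseq n p) M * trunct (u :: nseq v p) M =
    \sum_(1 <= l < n.+1) pprod v (n - l) (fun a =>
      trunct (nseq l p ++ u :: a) M
      + absorb t (trunct^~ M) (nseq (l - 1) p) (u + p) a)
    + pprod n v (fun a => trunct (u :: a) M).
Proof.
elim: n M => [|n IH] M.
  rewrite mul1r big_geq// add0r /= -qsum_pprod; apply: eq_qsum => r.
  by rewrite -trunct_nseq_mul mul1r.
have fgE r := trunct_nseq_mul n v r.
rewrite [LHS]qsum_mul -[LHS]addrA.
rewrite (eq_qsum _ _ IH) (eq_qsum _ _ fgE) (eq_dsum _ _ fgE) absorb_pprod qsum_expand.
rewrite [qsum u _ M](eq_qsum _ _ (fun r => trunct_nseq_mul n.+1 v r)) qsum_pprod.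
(* The summand l = 1 holds the words starting with [p], [u] and the merged letter [u + p]; the
   others are the induction hypothesis behind a new [p], with [l] shifted. *)
rewrite [X in _ = X + _]big_nat_recl// pprodD subSS subn0 !(pprod_sym _ _ v n).
set sumL := (X in X + _ + _ + _ = _).
rewrite [X in _ = _ + X + _](_ : _ = sumL) /=; first by rewrite [(p + u)%N]addnC; ring.
by apply: eq_big_nat => -[|l] // _; rewrite !subSS !subn0.
Qed.

Lemma trunct_cons_mul m u n v M :
  trunct (m :: nseq n p) M * trunct (u :: nseq v p) M =
  expansion t p (trunct^~ M) m u n v.
Proof.
have fgE r := trunct_nseq_mul n v r.
rewrite [LHS]qsum_mul -[LHS]addrA.
rewrite (eq_qsum _ _ fgE) (eq_dsum _ _ fgE) absorb_pprod.
rewrite [X in X + _ + _](eq_qsum _ _ (trunct_nseq_mul_cons u n v)) qsum_expand.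
(* Puts the block of [p] on the left, as [trunct_nseq_mul_cons] requires. *)
rewrite [X in _ + X + _](eq_qsum u M (fun r => mulrC _ (trunct (nseq v p) r))).
rewrite (eq_qsum _ _ (trunct_nseq_mul_cons m v n)) qsum_expand.
rewrite /expansion !pprodD (pprod_sym _ _ v n); ring.
Qed.

End TruncatedProduct.

(** * Expansion into ordinary truncated sums *)

Fixpoint truncz (A : pzSemiRingType) (y : nat -> A) (k : seq nat) (M : nat) : A :=
  if k is b :: k' then \sum_(r < M) y r ^+ b * truncz y k' r else 1.

Lemma sum_bool_tupleS (A : nmodType) n (F : n.+1.-tuple bool -> A) :
  \sum_b F b = \sum_(b : n.-tuple bool) F [tuple of true :: b]
               + \sum_(b : n.-tuple bool) F [tuple of false :: b].
Proof.
rewrite (reindex (fun x : bool * n.-tuple bool => [tuple of x.1 :: x.2])) /=.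
  by rewrite -(pair_bigA _ (fun (c : bool) (b : n.-tuple bool) => F [tuple of c :: b])) big_bool.
exists (fun b => (thead b, [tuple of behead b])) => [[c b] _|b _] /=.
  by congr (_, _); apply: val_inj.
by rewrite [RHS](tuple_eta b).
Qed.

Lemma size_box_fill k1 ks (b : bitseq) : (size (box_fill k1 ks b) <= (size ks).+1)%N.
Proof.
elim: ks k1 b => [|k2 ks IH] k1 [|[] b] //=; last exact: IH.
exact: leqW.
Qed.

(** Recursion on the first box: in [qsum] the term [f r] is the comma, and the increment with its
    factor t is the plus sign, by [dsum_trunct]. *)
Lemma trunct_box (A : comPzRingType) (t : A) (y : nat -> A) k1 ks M :
  trunct t y (k1 :: ks) M =
  \sum_(b : (size ks).-tuple bool) truncz y (box_fill k1 ks b) M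
     * t ^+ ((size ks).+1 - size (box_fill k1 ks b)).
Proof.
elim: ks k1 M => [|k2 ks IH] k1 M.
  rewrite (big_pred1 [tuple]) => [|b]; last exact/esym/eqP/tuple0.
  rewrite /= subnn mulr1; apply: eq_bigr => r _.
  by rewrite subrr mulr0 addr0.
transitivity (\sum_(r < M) y r ^+ k1 * trunct t y (k2 :: ks) r
              + t * dsum y k1 (trunct t y (k2 :: ks)) M).
  by rewrite mulr_sumr -big_split; apply: eq_bigr => r _ /=; ring.
rewrite dsum_trunct /addhead IH mulr_sumr sum_bool_tupleS addrC.
congr (_ + _).
  by apply: eq_bigr => b _ /=; rewrite [in RHS]subSn ?size_box_fill// exprS; ring.
under eq_bigr do rewrite IH mulr_sumr.
rewrite exchange_big; apply: eq_bigr => b _ /=.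
by rewrite subSS mulr_suml; apply: eq_bigr => r _; ring.
Qed.
(** * Convergence of truncated sums *)

Fixpoint decr (n M : nat) : seq (seq nat) :=
  if n is n'.+1 then
    flatten [seq [seq r.+1 :: s | s <- decr n' r] | r <- iota 0 M]
  else [:: [::]].

Lemma mem_decr n M s :
  (s \in decr n M) = [&& size s == n, path gtn M.+1 s & all (leq 1) s].
Proof.
elim: n M s => [|n IH] M s /=; first by rewrite inE; case: s.
apply/flatten_mapP/idP => [[r]|].
  rewrite mem_iota => /= ltrM /mapP[s' + ->] /=.
  by rewrite IH /= !ltnS eqSS => /and3P[-> -> ->]; rewrite ltrM.
case: s => [|[|r] s]//=; rewrite ?andbF//= eqSS => /and3P[ss /andP[rM ps] als].
by exists r; rewrite ?mem_iota// map_f// IH ss ps als.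
Qed.

Lemma decr_uniq n M : uniq (decr n M).
Proof.
elim: n M => // n IH M /=; apply: allpairs_uniq_dep; rewrite ?iota_uniq//.
by move=> [r s] [r' s'] _ _ /= [-> ->].
Qed.

Section TruncatedZeta.
Variable R : realType.

Definition recip (r : nat) : R := r.+1%:R^-1.

Notation tz := (truncz recip).

Lemma recip_ge0 r : 0 <= recip r. Proof. by rewrite invr_ge0. Qed.

Lemma truncz_ge0 k M : 0 <= tz k M.
Proof.
elim: k M => //= b k IH M; apply: sumr_ge0 => r _.
by rewrite mulr_ge0 ?exprn_ge0 ?recip_ge0.
Qed.

Lemma truncz_decr k M :
  tz k M = \sum_(m <- decr (size k) M)
             \prod_(i < size k) (nth 0%N m i)%:R ^- nth 0%N k i.
Proof.
elim: k M => [|b k IH] M /=; first by rewrite big_seq1 big_ord0.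
rewrite big_flatten big_map -/(index_iota 0 M).
rewrite -(big_mkord xpredT (fun r => recip r ^+ b * tz k r)) /index_iota subn0.
apply: eq_bigr => r _; rewrite big_map IH mulr_sumr; apply: eq_bigr => m _.
by rewrite big_ord_recl /= exprVn.
Qed.

Lemma truncz_homo k : {homo tz k : M N / (M <= N)%N >-> M <= N}.
Proof.
case: k => [|b k] M N leMN //=.
rewrite -!(big_mkord xpredT (fun r => recip r ^+ b * tz k r)).
rewrite (big_cat_nat (leq0n M) leMN) /= lerDl sumr_ge0// => r _.
by rewrite mulr_ge0 ?exprn_ge0 ?recip_ge0 ?truncz_ge0.
Qed.

(* Summation by parts against 1/(r+1) - 1/(r+2), one letter at a time. *)
Lemma truncz_telescope k M : all (leq 1) k ->
  \sum_(r < M) tz k r * (recip r * recip r.+1) + tz k M * recip M <= 1.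
Proof.
elim: k M => [|b k IH] M /=.
  move=> _; elim: M => [|M IH]; first by rewrite big_ord0 add0r /recip invr1 mulr1.
  apply: le_trans IH; rewrite big_ord_recr /= -addrA lerD2l !mul1r.
  rewrite /recip -!natr1 le_eqVlt; apply/orP; left; apply/eqP.
  have := ler0n R M; set x := M%:R => x0.
  by field; apply/andP; split; lra.
move=> /andP[b1 hk].
suff : \sum_(r < M) tz (b :: k) r * (recip r * recip r.+1) + tz (b :: k) M * recip M
    <= \sum_(r < M) tz k r * (recip r * recip r.+1).
  move=> /le_trans; apply; apply: le_trans (IH M hk).
  by rewrite lerDl mulr_ge0 ?truncz_ge0 ?recip_ge0.
elim: M => [|M IHM]; first by rewrite /= !big_ord0 mul0r addr0.
rewrite !big_ord_recr [tz (b :: k) M.+1]/= big_ord_recr -/(tz (b :: k) M).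
set X := \sum_(r < M) _ in IHM *; set Y := \sum_(r < M) _ in IHM *.
(* Uses 1/((M+1)(M+2)) + 1/(M+2) = 1/(M+1). *)
have -> : X + tz (b :: k) M * (recip M * recip M.+1)
   + (tz (b :: k) M + recip M ^+ b * tz k M) * recip M.+1
   = X + tz (b :: k) M * recip M + recip M ^+ b * (tz k M * recip M.+1).
  rewrite /recip -!natr1; have := ler0n R M; set x := M%:R => x0.
  set w := _ ^+ b; set z := tz _ _; set z' := tz _ _.
  by field; apply/andP; split; lra.
rewrite lerD// mulrCA ler_wpM2l ?truncz_ge0// ler_wpM2r ?recip_ge0//.
case: b b1 {IHM X Y} => // b _; rewrite exprS ler_piMr ?recip_ge0//.
by rewrite exprn_ile1 ?recip_ge0// invf_le1// ler1n.
Qed.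

(** Since 1/(r+1)^2 <= 2/((r+1)(r+2)), the sum is at most twice the one in [truncz_telescope]. *)
Lemma truncz_le2 b k M : (2 <= b)%N -> all (leq 1) k -> tz (b :: k) M <= 2.
Proof.
move=> b2 /(truncz_telescope M) le1.
have : \sum_(r < M) tz k r * (recip r * recip r.+1) <= 1.
  by apply: le_trans le1; rewrite lerDl mulr_ge0 ?truncz_ge0 ?recip_ge0.
rewrite -(ler_pM2l (ltr0n R 2)) mulr1 => /(le_trans _); apply.
rewrite mulr_sumr; apply: ler_sum => r _ /=.
rewrite -/(tz k r) mulrCA mulrC ler_wpM2l ?truncz_ge0//.
apply: (@le_trans _ _ (recip r ^+ 2)).
  by rewrite ler_wiXn2l ?recip_ge0// invf_le1// ler1n.
rewrite expr2 mulrCA ler_wpM2l ?recip_ge0// /recip -!natr1.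
have := ler0n R r; set x := r%:R => x0.
rewrite -[(x + 1)^-1]mul1r ler_pdivrMr; last by lra.
by rewrite mulrAC ler_pdivlMr; lra.
Qed.
End TruncatedZeta.
Section MzvLimit.
Local Open Scope classical_set_scope.
Local Open Scope ring_scope.
Variable R : realType.

Notation tz := (truncz (@recip R)).

(** Monotone bounded truncations tend to their supremum. It equals the unordered sum: each
    truncation is a finite partial sum, and each finite set of indices lies in some
    [decr (size K) M]. *)
Lemma cvg_truncz b k : (2 <= b)%N -> all (leq 1) k ->
  tz (b :: k) M @[M --> \oo] --> mzv R (b :: k).
Proof.
move=> b2 k1; set K := b :: k.
have ubd : has_ubound (range (tz K)).
  by exists 2 => _ [M _ <-]; exact: truncz_le2.
have := nondecreasing_cvgn (@truncz_homo R K) ubd; set L := sup _.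
suff -> : L = mzv R K by [].
pose f (m : seq nat) : \bar R :=
  (\prod_(i < size K) (nth 0%N m i)%:R ^- nth 0%N K i)%:E.
have f0 m : (0 <= f m)%E.
  by rewrite lee_fin prodr_ge0// => i _; rewrite invr_ge0 exprn_ge0.
have fsumE M : (\sum_(m \in [set` decr (size K) M]) f m)%R = (tz K M)%:E.
  by rewrite -fsbig_seq ?decr_uniq// sumEFin truncz_decr.
rewrite /mzv -/f; set e := esum _ _.
have e0 : (0 <= e)%E by apply: esum_ge0 => m _; exact: f0.
have leK M : ((tz K M)%:E <= e)%E.
  apply: ereal_sup_ubound; exists [set` decr (size K) M] => //.
  split; first exact: finite_seq.
  by move=> m; rewrite /mkset mem_decr => /and3P[/eqP sm /path_sorted pm am].
have eL : (e <= L%:E)%E.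
  apply: ge_ereal_sup => _ [A [finA subA] <-].
  have [M hM] : exists M, forall m, A m -> (head 0%N m <= M)%N.
    have /finite_seqP[s AE] := finA.
    exists (\max_(m <- s) head 0%N m) => m Am.
    by apply: leq_bigmax_seq => //; move: Am; rewrite AE.
  apply: (@le_trans _ _ (tz K M)%:E); last first.
    by rewrite lee_fin ub_le_sup//; exists M.
  rewrite -fsumE; apply: lee_fsum_nneg_subset => //; first exact: finite_seq.
  move=> m; rewrite inE => Am; rewrite inE /mkset mem_decr.
  have [sm om am] := subA _ Am; rewrite sm am eqxx andbT /=.
  by case: m Am om {sm am} => // x m /hM /= xM ->; rewrite andbT ltnS.
(* Finiteness makes [fine] return the sum itself and not its default 0. *)
have efin : e \is a fin_num.
  by rewrite ge0_fin_numE// (le_lt_trans eL)// ltry.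
apply/le_anti/andP; split; last by rewrite -lee_fin fineK.
apply: ge_sup; first by exists (tz K 0), 0%N.
by move=> _ [M _ <-]; rewrite -lee_fin fineK.
Qed.

Lemma cvg_sumr (I : Type) (s : seq I) (P : pred I) (f : I -> nat -> R) (l : I -> R) :
  (forall i, P i -> f i M @[M --> \oo] --> l i) ->
  \sum_(i <- s | P i) f i M @[M --> \oo] --> \sum_(i <- s | P i) l i.
Proof. by move=> fl; apply: cvg_big => //; exact: add_continuous. Qed.

End MzvLimit.

(** * Passage to the limit *)

(** The default 0 of [head] excludes the empty word, where [trunct] is 1 but [mzvt] has its dummy
    value 0. *)
Definition admissible (k : seq nat) := (2 <= head 0%N k)%N && all (leq 1) k.

Lemma box_fill_admissible k1 ks b :
  admissible (k1 :: ks) -> admissible (box_fill k1 ks b).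
Proof.
have gt0 c l b' : (0 < c)%N -> all (leq 1) l -> all (leq 1) (box_fill c l b').
  elim: l c b' => [|d l IH] c [|[] b'] //=; rewrite ?andbT// => c0 /andP[d0 hl].
    by apply: IH; rewrite // addn_gt0 c0.
  by rewrite c0 IH.
have ge2 c l b' : (2 <= c)%N -> (2 <= head 0%N (box_fill c l b'))%N.
  elim: l c b' => [|d l IH] c [|[] b'] //= c2.
  by apply: IH; rewrite (leq_trans c2)// leq_addr.
by rewrite /admissible /= => /andP[k2 /andP[k0 hk]]; rewrite ge2 ?gt0.
Qed.

Section Limit.
Local Open Scope classical_set_scope.
Local Open Scope ring_scope.
Variables (R : realType) (t : R).

Lemma cvg_trunct k : admissible k ->
  trunct t (@recip R) k M @[M --> \oo] --> (mzvt R k).[t].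
Proof.
case: k => // k1 ks adm; under eq_fun do rewrite trunct_box.
rewrite /mzvt horner_sum; apply: cvg_sumr => b _.
rewrite hornerZ hornerXn; apply: cvgM; last exact: cvg_cst.
have := box_fill_admissible b adm; case: box_fill => // c l /andP[c2 /andP[_ hl]].
exact: cvg_truncz.
Qed.

Variable p : nat.
Hypothesis p0 : (0 < p)%N.

Lemma cvg_pprod n v (Z : nat -> seq nat -> R) (L : seq nat -> R) :
  (forall a, all (leq 1) a -> Z M a @[M --> \oo] --> L a) ->
  pprod t p n v (Z M) @[M --> \oo] --> pprod t p n v L.
Proof.
move=> ZL; rewrite /pprod big_seq_cond.
under eq_fun do rewrite big_seq_cond.
apply: cvg_sumr => a; rewrite andbT mem_comps// => /andP[ha _].
apply: cvgM; first exact: cvg_cst.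
by apply: ZL; apply: sub_all ha => x /andP[].
Qed.

(** Admissibility of [rcons pre b] treats alike an empty prefix, where [b] leads the word, and a
    nonempty one. *)
Lemma cvg_absorb (Z : nat -> seq nat -> R) (L : seq nat -> R) pre b a :
  (forall k, admissible k -> Z M k @[M --> \oo] --> L k) ->
  all (leq 1) a -> (0 < b)%N -> admissible (rcons pre b) ->
  absorb t (Z M) pre b a @[M --> \oo] --> absorb t L pre b a.
Proof.
move=> ZL ha b0.
have adm c l : (b <= c)%N -> all (leq 1) l -> admissible (rcons pre b) ->
    admissible (pre ++ c :: l).
  move=> bc hl; rewrite /admissible all_rcons => /andP[h2 /andP[_ hp]].
  rewrite all_cat hp /= hl (leq_trans b0 bc) !andbT.
  by case: (pre) h2 => //= /leq_trans; apply.
move=> hpre; apply: cvgD; apply: cvgM; try exact: cvg_cst.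
  by apply: ZL; exact: adm.
case: a ha => [|x a] /=; first by move=> _; exact: cvg_cst.
by move=> /andP[_ ha]; apply/ZL/adm; rewrite ?leq_addr.
Qed.

Lemma cvg_expansion (Z : nat -> seq nat -> R) (L : seq nat -> R) m u n v :
  (2 <= m)%N -> (2 <= u)%N ->
  (forall k, admissible k -> Z M k @[M --> \oo] --> L k) ->
  expansion t p (Z M) m u n v @[M --> \oo] --> expansion t p L m u n v.
Proof.
move=> m2 u2 ZL.
have m0 := ltnW m2; have u0 := ltnW u2.
have step q c n' v' : (2 <= q)%N -> (0 < c)%N ->
  \sum_(1 <= l < n'.+1) pprod t p v' (n' - l) (fun a =>
    Z M (q :: nseq l p ++ c :: a) + absorb t (Z M) (q :: nseq (l - 1) p) (c + p) a)
  @[M --> \oo] -->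
  \sum_(1 <= l < n'.+1) pprod t p v' (n' - l) (fun a =>
    L (q :: nseq l p ++ c :: a) + absorb t L (q :: nseq (l - 1) p) (c + p) a).
  move=> q2 c0; apply: cvg_sumr => l _; apply: cvg_pprod => a ha; apply: cvgD.
    by apply: ZL; rewrite /admissible /= q2 ltnW// all_cat all_nseq p0 orbT /= c0.
  apply: cvg_absorb; rewrite ?addn_gt0 ?c0//.
  by rewrite /admissible /= q2 ltnW// all_rcons all_nseq p0 orbT addn_gt0 c0.
apply: cvgD; first by apply: cvgD; exact: step.
apply: cvg_pprod => a ha; apply: cvgD.
  by apply: cvgD; apply: ZL; rewrite /admissible /= ?m2 ?u2 ?m0 ?u0.
apply: cvg_absorb; rewrite ?addn_gt0 ?m0//.
by rewrite /admissible /= (leq_trans m2) ?leq_addr// addn_gt0 m0.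
Qed.
End Limit.

(** * From real values of t to polynomials *)

Section Morphism.
Variables (A B : comPzRingType) (f : {rmorphism A -> B}) (t : A) (p : nat).

Lemma rmorph_pprod n v (Z : seq nat -> A) :
  f (pprod t p n v Z) = pprod (f t) p n v (f \o Z).
Proof.
rewrite rmorph_sum; apply: eq_bigr => a _.
by rewrite !(rmorphM, rmorphXn, rmorphB, rmorph_nat, rmorph1).
Qed.

Lemma rmorph_absorb (Z : seq nat -> A) pre b a :
  f (absorb t Z pre b a) = absorb (f t) (f \o Z) pre b a.
Proof.
rewrite rmorphD !(rmorphM, rmorphXn, rmorphB, rmorph_nat, rmorph1).
by congr (_ + _ * _); case: a => [|x a] //=; rewrite rmorph0.
Qed.

Lemma rmorph_expansion (Z : seq nat -> A) m u n v :
  f (expansion t p Z m u n v) = expansion (f t) p (f \o Z) m u n v.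
Proof.
rewrite !rmorphD; congr (_ + _ + _).
- rewrite rmorph_sum; apply: eq_bigr => l _; rewrite rmorph_pprod; apply: eq_pprod => a /=.
  by rewrite rmorphD; congr (_ + _); exact: rmorph_absorb.
- rewrite rmorph_sum; apply: eq_bigr => l _; rewrite rmorph_pprod; apply: eq_pprod => a /=.
  by rewrite rmorphD; congr (_ + _); exact: rmorph_absorb.
- rewrite rmorph_pprod; apply: eq_pprod => a /=.
  by rewrite rmorphD; congr (_ + _); [exact: rmorphD|exact: rmorph_absorb].
Qed.
End Morphism.

(** A nonzero difference would vanish at as many distinct integers as its size, which exceeds its
    degree. *)
Lemma poly_ext (R : numDomainType) (P Q : {poly R}) :
  (forall t, P.[t] = Q.[t]) -> P = Q.
Proof.
move=> PQ; apply/eqP; rewrite -subr_eq0; apply/negP => /negP D0.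
pose s := [seq i%:R | i <- iota 0 (size (P - Q))] : seq R.
have us : uniq s by rewrite map_inj_uniq ?iota_uniq//; exact: mulrIn (oner_neq0 R).
have rs : all (root (P - Q)) s.
  by apply/allP => t _; rewrite /root hornerD hornerN PQ subrr.
by have := max_poly_roots D0 rs us; rewrite size_map size_iota ltnn.
Qed.

Lemma mzvt_mul (R : realType) (m u p n v : nat) :
  (2 <= m)%N -> (2 <= u)%N -> (0 < p)%N ->
  mzvt R (m :: nseq n p) * mzvt R (u :: nseq v p) =
  expansion 'X p (mzvt R) m u n v.
Proof.
move=> m2 u2 p0; apply: poly_ext => t.
have adm q l : (2 <= q)%N -> admissible (q :: nseq l p).
  by move=> q2; rewrite /admissible /= q2 ltnW// all_nseq p0 orbT.
rewrite hornerM -[RHS]/(horner_eval t _) rmorph_expansion /= [horner_eval t _]hornerX.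
have := @cvg_expansion R t p p0 (fun M k => trunct t (@recip R) k M)
  (fun k => (mzvt R k).[t]) m u n v m2 u2 (@cvg_trunct R t).
under eq_fun do rewrite -trunct_cons_mul//.
move=> lim_expansion; apply: cvg_unique lim_expansion; first exact: Rhausdorff.
by apply: cvgM; apply: cvg_trunct; exact: adm.
Qed.

(** * Return to the indexing of the theorem *)

Lemma sum_calA_eq (A : comPzRingType) (t : A) p n v M M' (F Z : seq nat -> A) :
  (0 < p)%N -> M = (n + v)%N -> M' = (n + v)%N ->
  (forall a, in_comps p (n + v) a -> F a = Z a) ->
  \sum_(0 <= k < (minn n v).+1)
   \sum_(i < k.+1) \sum_(j < k.+1 | (i + j == k)%N)
    \sum_(a <- calA p (M - i - k) M' j)
     'C(M - 2 * k, n - k)%:R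
     * (t ^+ 2 - t) ^+ i * (1 - 2 * t) ^+ j * F a = pprod t p n v Z.
Proof.
move=> p0 -> -> FZ; rewrite sum_calA//; apply: eq_big_seq => a.
by rewrite mem_comps// => /FZ->.
Qed.

(** The factor 1 - [b1] [b2] is 0 only if both are true; then the total is 0, the word is empty and
    the last term is 0 on both sides. Otherwise the factor is 1. *)
Lemma absorb_delta (A : comPzRingType) (t : A) (Z : seq nat -> A) p M pre b (b1 b2 : bool) a :
  (b1 && b2 -> M = 0%N) -> in_comps p M a ->
  (1 - 2 * t) * Z (pre ++ b :: a)
  + (1 - b1%:R * b2%:R) * (t ^+ 2 - t)
    * (if a is a1 :: a' then Z (pre ++ (b + a1)%N :: a') else 0)
  = absorb t Z pre b a.
Proof.
rewrite /absorb; case: a => [|x a]; first by rewrite !mulr0.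
case: b1; case: b2; rewrite /= ?(mulr1, mulr0, mul0r, subr0, mul1r)//.
move=> -> // /andP[/andP[/andP[x0 _] _]] /=.
by rewrite mul0n addn_eq0 (gtn_eqF x0).
Qed.

Theorem theorem3 (R : realType) (m u p n v : nat)
    (hm : (2 <= m)%N) (hu : (2 <= u)%N) (hp : (1 <= p)%N) :
  mzvt R (m :: nseq n p) * mzvt R (u :: nseq v p) =
    \sum_(1 <= l < n.+1) \sum_(0 <= k < (minn v (n - l)).+1)
     \sum_(i < k.+1) \sum_(j < k.+1 | (i + j == k)%N)
      \sum_(a <- calA p (v + n - l - i - k) (n + v - l) j)
       'C(v + n - l - 2 * k, v - k)%:R
       * ('X^2 - 'X) ^+ i * (1 - 2 * 'X) ^+ j
       * (mzvt R (m :: nseq l p ++ u :: a)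
          + (1 - 2 * 'X) * mzvt R (m :: nseq (l - 1) p ++ (u + p)%N :: a)
          + (1 - (v == 0)%N%:R * (n == l)%N%:R) * ('X^2 - 'X)
            * (if a is a1 :: a' then
                 mzvt R (m :: nseq (l - 1) p ++ (u + p + a1)%N :: a')
               else 0))
  + \sum_(1 <= l < v.+1) \sum_(0 <= k < (minn n (v - l)).+1)
     \sum_(i < k.+1) \sum_(j < k.+1 | (i + j == k)%N)
      \sum_(a <- calA p (v + n - l - i - k) (n + v - l) j)
       'C(v + n - l - 2 * k, n - k)%:R
       * ('X^2 - 'X) ^+ i * (1 - 2 * 'X) ^+ j
       * (mzvt R (u :: nseq l p ++ m :: a)
          + (1 - 2 * 'X) * mzvt R (u :: nseq (l - 1) p ++ (m + p)%N :: a)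
          + (1 - (n == 0)%N%:R * (v == l)%N%:R) * ('X^2 - 'X)
            * (if a is a1 :: a' then
                 mzvt R (u :: nseq (l - 1) p ++ (m + p + a1)%N :: a')
               else 0))
  + \sum_(0 <= k < (minn n v).+1)
     \sum_(i < k.+1) \sum_(j < k.+1 | (i + j == k)%N)
      \sum_(a <- calA p (v + n - i - k) (n + v) j)
       'C(v + n - 2 * k, n - k)%:R
       * ('X^2 - 'X) ^+ i * (1 - 2 * 'X) ^+ j
       * (mzvt R [:: m, u & a] + mzvt R [:: u, m & a]
          + (1 - 2 * 'X) * mzvt R ((m + u)%N :: a)
          + (1 - (n == 0)%N%:R * (v == 0)%N%:R) * ('X^2 - 'X)
            * (if a is a1 :: a' then mzvt R ((m + u + a1)%N :: a') else 0)).
Proof.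
rewrite mzvt_mul//; apply/esym; congr (_ + _ + _).
- apply: eq_big_nat => l /andP[l1 ln]; apply: sum_calA_eq => //; try lia.
  move=> a ha; rewrite -addrA; congr (_ + _).
  (* Both deltas are 1 only for v = 0 and l = n, where the total v + (n - l) is 0. *)
  by apply: (absorb_delta _ _ (m :: nseq (l - 1) p) _ _ ha) => /andP[/eqP-> /eqP->]; rewrite subnn.
- apply: eq_big_nat => l /andP[l1 lv]; apply: sum_calA_eq => //; try lia.
  move=> a ha; rewrite -addrA; congr (_ + _).
  by apply: (absorb_delta _ _ (u :: nseq (l - 1) p) _ _ ha) => /andP[/eqP-> /eqP->]; rewrite subnn.
- apply: sum_calA_eq => //; first by rewrite addnC.
  move=> a ha; rewrite -addrA; congr (_ + _).
  by apply: (absorb_delta _ _ [::] _ _ ha) => /andP[/eqP-> /eqP->].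
Qed.
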